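(* Let $f:\mathcal{X}\to\mathcal{Y}$ be a deterministic probabilistic black-box classifier, where $\mathcal{Y}$ is the set of $n$-dimensional probability vectors, and let $C\subseteq\{1,\ldots,n\}$ be the set of classes to be explained. Let $\mathcal{X}^\prime=\{0,1\}^d$ be a binary interpretable domain. Suppose the interpretable representation transformation function $\mathit{IR}:\mathcal{X}\to\mathcal{X}^\prime$, with inverse transformation $\mathit{IR}^{-1}:\mathcal{X}^\prime\to\mathcal{X}$, is deterministic, so that the mapping between points of $\mathcal{X}^\prime$ and the corresponding instances of $\mathcal{X}$ is one-to-one. Let $g$ be a binary multi-output decision (regression) tree on $\mathcal{X}^\prime$ with set of leaves $T$. Then $g$ can achieve full structural fidelity. That is, without changing the structure of $g$ (its splits and leaves), its leaf values can be chosen such that $$f_c\bigl(\mathit{IR}^{-1}(x^\prime)\bigr)=g_c(x^\prime)\qquad\text{for all } c\in C \text{ and all } x^\prime\in X^\prime_{\mathit{min},T},$$ where $X^\prime_{\mathit{min},T}\subseteq\mathcal{X}^\prime$ is the minimal representation set of the tree.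
   Context: Trees. A binary multi-output regression tree $g$ on $\mathcal{X}^\prime=\{0,1\}^d$ ($d\ge 1$) is a finite rooted binary tree. Each internal node tests one coordinate by $x^\prime_i<1/2$, sending points with $x^\prime_i=0$ to one child and points with $x^\prime_i=1$ to the other. Each leaf $t\in T$ carries a vector of real values $(v_{t,c})_{c\in C}$. Write $g_{\mathit{id}}(x^\prime)\in T$ for the leaf reached by $x^\prime$. The prediction for class $c$ is $g_c(x^\prime)=v_{g_{\mathit{id}}(x^\prime),c}$. Every leaf is assumed to be reached by at least one point of $\mathcal{X}^\prime$. Minimal representation. For a leaf $t\in T$, the minimal data point $x^\prime_{\mathit{min},t}$ is the (unique) point $$x^\prime_{\mathit{min},t}=\arg\max_{x^\prime\in\mathcal{X}^\prime}\ \sum_{i=1}^d x^\prime_i\quad\text{subject to}\quad g_{\mathit{id}}(x^\prime)=t .$$ The minimal representation set is $X^\prime_{\mathit{min},T}=\{x^\prime_{\mathit{min},t}:t\in T\}$. It depends only on the structure of the tree, not on its leaf values. Deterministic interpretable representation. $\mathit{IR}$ and $\mathit{IR}^{-1}$ are (single-valued, non-random) functions with $\mathit{IR}(\mathit{IR}^{-1}(x^\prime))=x^\prime$ for every $x^\prime\in\mathcal{X}^\prime$. Equivalently, $\mathit{IR}^{-1}$ is injective and $\mathit{IR}$ restricted to the image $\mathit{IR}^{-1}(\mathcal{X}^\prime)$ inverts it, so that $\mathit{IR}^{-1}(\mathit{IR}(x))=x$ for every $x$ in that image. $f_c(x)$ denotes the $c$-th component of $f(x)$. Deterministic black box means that $f$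 is a genuine function, always giving the same output on the same input. Structural fidelity (fidelity of model-driven explanations, i.e., those derived from the tree structure) means agreement of $f_c\circ\mathit{IR}^{-1}$ and $g_c$ on $X^\prime_{\mathit{min},T}$ for all $c\in C$. *)

(* Defs.v *)
From HB Require Import structures.
From mathcomp Require Import all_boot all_order all_algebra.
From mathcomp Require Import reals.

Set Implicit Arguments.
Unset Strict Implicit.
Unset Printing Implicit Defensive.

Import GRing.Theory Num.Theory.
Local Open Scope ring_scope.

Record prob_vector (R : realType) (n : nat) := ProbVector {
  prob_val :> {ffun 'I_n -> R};
  prob_ge0 : forall c : 'I_n, 0 <= prob_val c;
  prob_sum1 : \sum_(c < n) prob_val c = 1
}.

Definition binary_domain (d : nat) : finType := {ffun 'I_d -> bool}.

Inductive splits (d : nat) : Type :=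
| Leaf
| Split (i : 'I_d) (l r : splits d).

Arguments Leaf {d}.

(* The leaves are the root-to-leaf paths, so distinct leaves of the tree are
   always distinct elements of this type. *)
Fixpoint leaf (d : nat) (s : splits d) : finType :=
  match s with
  | Leaf => unit : finType
  | Split _ l r => (leaf l + leaf r)%type : finType
  end.

(* The test x_i < 1/2 sends points with x_i = 0, i.e. false, to the left child
   and points with x_i = 1, i.e. true, to the right child. *)
Fixpoint leaf_id (d : nat) (s : splits d) (x : binary_domain d) : leaf s :=
  match s return leaf s with
  | Leaf => tt
  | Split i l r => if x i then inr (leaf_id r x) else inl (leaf_id l x)
  end.

Record tree_structure (d : nat) := TreeStructure {
  tree_splits :> splits d;
  leaf_reached : forall t : leaf tree_splits,
    exists x : binary_domain d, leaf_id tree_splits x == t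
}.

Record regression_tree (R : realType) (d n : nat) (C : {set 'I_n}) :=
  RegressionTree {
    structure : tree_structure d;
    leaf_value : leaf structure -> {ffun {c : 'I_n | c \in C} -> R}
  }.

Definition predict (R : realType) (d n : nat) (C : {set 'I_n})
    (g : regression_tree R d C) (c : {c : 'I_n | c \in C})
    (x : binary_domain d) : R :=
  leaf_value (leaf_id (structure g) x) c.

Definition num_ones (d : nat) (x : binary_domain d) : nat :=
  (\sum_(i < d) x i)%N.

(* The point given by xchoose only witnesses that the constraint is feasible;
   the maximiser does not depend on it (min_point_unique). *)
Definition min_point (d : nat) (s : tree_structure d) (t : leaf s) :
    binary_domain d :=
  [arg max_(x > xchoose (leaf_reached t) | leaf_id s x == t) num_ones x].

Definition min_set (d : nat) (s : tree_structure d) : {set binary_domain d} :=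
  [set min_point t | t : leaf s].

Definition full_structural_fidelity (R : realType) (d n : nat)
    (C : {set 'I_n}) (X : Type) (f : X -> prob_vector R n)
    (IRinv : binary_domain d -> X) (g : regression_tree R d C) : Prop :=
  forall (c : {c : 'I_n | c \in C}) (x : binary_domain d),
    x \in min_set (structure g) -> f (IRinv x) (val c) = predict g c x.

Lemma leaf_id_or (d : nat) (s : splits d) (x y : binary_domain d) :
  leaf_id s x = leaf_id s y ->
  leaf_id s [ffun i => x i || y i] = leaf_id s x.
Proof.
elim: s => [|i l IHl r IHr] //=; rewrite ffunE.
case: (x i); case: (y i) => //= -[].
  by move/IHr=> ->.
by move/IHl=> ->.
Qed.

Lemma num_ones_or (d : nat) (x y : binary_domain d) :
  (num_ones [ffun i => (x i || y i)] <= num_ones x)%N ->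
  [ffun i => x i || y i] = x.
Proof.
have E i : (true -> x i <= (x i || y i) ?= iff ((x i || y i) == x i))%N.
  by case: (x i); case: (y i).
have [le_sum eq_sum] := leqif_sum E.
have -> : num_ones [ffun i => (x i || y i)] = (\sum_i (x i || y i))%N.
  by apply: eq_bigr => i _; rewrite ffunE.
move=> ge_sum; move: eq_sum; rewrite eqn_leq le_sum ge_sum /= => /esym/forallP h.
by apply/ffunP => i; rewrite ffunE; apply/eqP/(implyP (h i)).
Qed.

Lemma min_point_unique (d : nat) (s : tree_structure d) (t : leaf s)
    (x : binary_domain d) :
  (leaf_id s x = t /\
   forall y, leaf_id s y = t -> (num_ones y <= num_ones x)%N) <->
  x = min_point t.
Proof.
rewrite /min_point.
case: arg_maxnP; first exact: (xchooseP (leaf_reached t)).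
move=> m /eqP mt m_max.
split=> [[xt x_max]|->]; last by split=> // y /eqP; apply: m_max.
have xm : leaf_id s x = leaf_id s m by rewrite xt mt.
have ot := leaf_id_or xm; rewrite xt in ot.
rewrite -(num_ones_or (x_max _ ot)).
rewrite -[RHS](@num_ones_or _ m x).
  by apply/ffunP => i; rewrite !ffunE orbC.
by apply: m_max; rewrite (leaf_id_or (esym xm)) mt.
Qed.

(* Main.v *)
(* Distinct leaves have distinct minimal points, since each minimal point
   reaches its own leaf, so the value of the black box at the minimal point of
   a leaf can be assigned to that leaf without conflict. *)
Require Import Defs.
From HB Require Import structures.
From mathcomp Require Import all_boot all_order all_algebra.
From mathcomp Require Import reals.

(** The converse direction of [min_point_unique], taken at the minimal point itself, yields both the
    constraint and the maximality of the arg max; the constraint is what is kept. *)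
Lemma leaf_id_min_point (d : nat) (s : tree_structure d) (t : leaf s) :
  leaf_id s (min_point t) = t.
Proof. by have [_ /(_ erefl) []] := min_point_unique t (min_point t). Qed.

Theorem lemma1 (R : realType) (d n : nat) (hd : (0 < d)%N)
    (X : Type) (f : X -> prob_vector R n) (C : {set 'I_n})
    (IR : X -> binary_domain d) (IRinv : binary_domain d -> X)
    (hIR : cancel IRinv IR)
    (g : regression_tree R d C) :
  exists g' : regression_tree R d C,
    structure g' = structure g /\ full_structural_fidelity f IRinv g'.
Proof.
(* Minimal points depend on the splits alone, so they can define the new leaf values without
   circularity. *)
exists (@RegressionTree R d n C (structure g)
  (fun t => [ffun c => f (IRinv (min_point t)) (val c)])).
split=> // c x /imsetP[t _ ->].
(* The prediction unfolds to [f] at the minimal point of the leaf that [min_point t] reaches, and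
   that leaf is [t]. *)
by rewrite /predict /= ffunE leaf_id_min_point.
Qed.
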